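(* Let $T\in(0,\infty]$ and let $H_S\in\mathbb C^{2\times 2}$ be Hermitian and non-degenerate (two distinct eigenvalues). For all $S_1,S_2\in\mathsf{EnTO}(H_S,T)$ one has $S_1\circ S_2=S_2\circ S_1$. In particular any two elements of any subset of $\mathsf{EnTO}(H_S,T)$ commute.
   Context: The enhanced thermal operations $\mathsf{EnTO}(H_S,T)$ are all completely positive trace-preserving linear maps $S$ on $\mathbb C^{2\times 2}$ with $S(e^{-H_S/T})=e^{-H_S/T}$ (resp. $S(\mathbb 1)=\mathbb 1$ if $T=\infty$) and $[S,\operatorname{ad}_{H_S}]=0$, where $\operatorname{ad}_{H_S}=[H_S,\cdot\,]$. *)

(* Defs.v *)
From HB Require Import structures.
From mathcomp Require Import all_boot all_order all_algebra.
From mathcomp Require Import sesquilinear spectral.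
From mathcomp Require Import all_classical all_reals all_analysis.
From mathcomp Require Import complex.

Set Implicit Arguments.
Unset Strict Implicit.
Unset Printing Implicit Defensive.

Import Order.TTheory GRing.Theory Num.Theory.
Import numFieldNormedType.Exports.

Local Open Scope ring_scope.
Local Open Scope classical_set_scope.
Local Open Scope sesquilinear_scope.

(* Over C = R[i] with R : realType the series converges for every A, so that
   limn is its sum. Abstracting C lets the canonical topology that the library
   puts on numClosedFieldType (and on matrices over it) be used. *)
Definition mxexp (C : numClosedFieldType) n (A : 'M[C]_n) : 'M[C]_n :=
  limn (series (fun k => k`!%:R^-1 *: A ^+ k)).

(* In the partial order of C, 0 <= z includes that z is real. *)
Definition psdmx (C : numClosedFieldType) n (A : 'M[C]_n) : Prop :=
  forall v : 'cV[C]_n, 0 <= (v^t* *m A *m v) 0 0.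

(* id_k (x) S, where M_k (x) M_n is the algebra of k x k block matrices with
   n x n blocks: S acts on each block. *)
Definition ampliation (C : numClosedFieldType) n k (S : 'M[C]_n -> 'M[C]_n)
    (X : 'M[C]_(\sum_(i < k) n)) : 'M[C]_(\sum_(i < k) n) :=
  \mxblock_(i < k, j < k) S (submxblock X i j).

Definition completely_positive (C : numClosedFieldType) n
    (S : 'M[C]_n -> 'M[C]_n) : Prop :=
  forall (k : nat) (X : 'M[C]_(\sum_(i < k) n)),
    psdmx X -> psdmx (ampliation S X).

Definition trace_preserving (C : numClosedFieldType) n
    (S : 'M[C]_n -> 'M[C]_n) : Prop :=
  forall X, \tr (S X) = \tr X.

Definition ad (C : numClosedFieldType) n (H X : 'M[C]_n) : 'M[C]_n :=
  H *m X - X *m H.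

(* The unnormalized thermal state e^{-H/T}, read as 1 at T = +oo; the value at
   T = -oo is irrelevant, temperatures being positive. *)
Definition gibbs (R : realType) n (H : 'M[R[i]]_n) (T : \bar R) : 'M[R[i]]_n :=
  if T is t%:E%E then mxexp (- ((t^-1)%:C)%C *: H) else 1%:M.

Definition EnTO (R : realType) n (H : 'M[R[i]]_n) (T : \bar R) :
    set {linear 'M[R[i]]_n -> 'M[R[i]]_n} :=
  [set S | [/\ completely_positive S, trace_preserving S,
               S (gibbs H T) = gibbs H T &
               forall X, S (ad H X) - ad H (S X) = 0] ].

(* Main.v *)
(** In an eigenbasis of H, with matrix units F i j and eigenvalues d 0 and d 1,
    the eigenvalues of ad H are d 0 - d 1, d 1 - d 0 (both simple) and 0, with
    eigenvectors F 0 1, F 1 0 and the plane of diagonal matrices. A map S that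
    commutes with ad H thus acts as a scalar on F 0 1 and on F 1 0, and
    preserves the plane. Trace preservation makes the traceless line spanned by
    F 0 0 - F 1 1 stable under S, while the Gibbs state G lies in the plane, is
    fixed by S and has positive trace. Hence all enhanced thermal operations are
    diagonal in the common basis F 0 1, F 1 0, F 0 0 - F 1 1, G. *)

Require Import Defs.
From HB Require Import structures.
From mathcomp Require Import all_boot all_order all_algebra.
From mathcomp Require Import sesquilinear spectral.
From mathcomp Require Import all_classical all_reals all_analysis.
From mathcomp Require Import complex.

Set Implicit Arguments.
Unset Strict Implicit.
Unset Printing Implicit Defensive.

Import Order.TTheory GRing.Theory Num.Theory.
Import numFieldNormedType.Exports.

Local Open Scope ring_scope.
Local Open Scope classical_set_scope.

(** * Coordinates and diagonal calculus after conjugation by an invertible [V] *)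

Lemma conjmx_delta_sum (C : numClosedFieldType) n (V : 'M[C]_n)
    (V_unit : V \in unitmx) (X : 'M[C]_n) :
  X = \sum_i \sum_j
    (V *m X *m invmx V) i j *: (invmx V *m delta_mx i j *m V).
Proof.
have {1}-> : X = invmx V *m (V *m X *m invmx V) *m V.
  by rewrite !mulmxA mulVmx // mul1mx -mulmxA mulVmx // mulmx1.
rewrite {1}[V *m X *m invmx V]matrix_sum_delta mulmx_sumr mulmx_suml.
apply: eq_bigr => i _; rewrite mulmx_sumr mulmx_suml.
by apply: eq_bigr => j _; rewrite -scalemxAr -scalemxAl.
Qed.

Lemma conj_diag_delta_sum (C : numClosedFieldType) n (V : 'M[C]_n)
    (d : 'rV[C]_n) :
  invmx V *m diag_mx d *m V =
  \sum_i d 0 i *: (invmx V *m delta_mx i i *m V).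
Proof.
rewrite diag_mx_sum_delta mulmx_sumr mulmx_suml.
by apply: eq_bigr => i _; rewrite -scalemxAr -scalemxAl.
Qed.

Lemma conj_diag_mul (C : numClosedFieldType) n (V : 'M[C]_n)
    (V_unit : V \in unitmx) (d e : 'rV[C]_n) :
  (invmx V *m diag_mx d *m V) *m (invmx V *m diag_mx e *m V) =
  invmx V *m diag_mx (\row_i (d 0 i * e 0 i)) *m V.
Proof.
rewrite -mulmx_diag !mulmxA; congr (_ *m _ *m _).
by rewrite -mulmxA mulmxV // mulmx1.
Qed.

Lemma ad_conj_diag (C : numClosedFieldType) n (V : 'M[C]_n)
    (V_unit : V \in unitmx) (d e : 'rV[C]_n) :
  ad (invmx V *m diag_mx d *m V) (invmx V *m diag_mx e *m V) = 0.
Proof.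
rewrite /ad !conj_diag_mul //; apply/eqP; rewrite subr_eq0; apply/eqP.
by congr (_ *m diag_mx _ *m _); apply/rowP => i; rewrite !mxE mulrC.
Qed.

(** * Exponentials of diagonalizable matrices *)

Lemma conj_diag_exp (C : numClosedFieldType) n (V : 'M[C]_n)
    (V_unit : V \in unitmx) (d : 'rV[C]_n) k :
  (invmx V *m diag_mx d *m V) ^+ k =
  invmx V *m diag_mx (\row_i d 0 i ^+ k) *m V.
Proof.
elim: k => [|k IHk].
  rewrite expr0 (_ : \row_i _ = const_mx 1) ?diag_const_mx; last first.
    by apply/rowP => i; rewrite !mxE expr0.
  by rewrite mulmx1 mulVmx.
rewrite exprS IHk -[(_ * _)%R]/(_ *m _) conj_diag_mul //.
by congr (_ *m diag_mx _ *m _); apply/rowP => i; rewrite !mxE exprS.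
Qed.

(** The partial sums are combinations of the fixed matrices [invmx V *m delta_mx i i *m V], with
    scalar partial sums as coefficients, so the limit passes through a finite sum. Over an abstract
    [C], convergence of the scalar series is a hypothesis on each eigenvalue. *)
Lemma mxexp_conj_diag (C : numClosedFieldType) n (V : 'M[C]_n)
    (V_unit : V \in unitmx) (d e : 'rV[C]_n) :
  (forall i, series (fun k => k`!%:R^-1 * d 0 i ^+ k) @ \oo --> e 0 i) ->
  mxexp (invmx V *m diag_mx d *m V) = invmx V *m diag_mx e *m V.
Proof.
move=> de; rewrite /mxexp; apply: cvg_lim; first exact: norm_hausdorff.
rewrite [in X in _ --> X]conj_diag_delta_sum.
rewrite [X in X @ _](_ : _ = fun N => \sum_i
    series (fun k => k`!%:R^-1 * d 0 i ^+ k) N *: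
    (invmx V *m delta_mx i i *m V)); last first.
  apply/funext => N; rewrite /series /=.
  under eq_bigr => k _ do rewrite conj_diag_exp // conj_diag_delta_sum
    scaler_sumr.
  rewrite exchange_big; apply: eq_bigr => i _ /=; rewrite scaler_suml.
  by apply: eq_bigr => k _; rewrite mxE scalerA.
apply: cvg_big => [|i _]; first exact: add_continuous.
by apply: cvgZr_tmp; exact: de.
Qed.

Lemma cvg_real_complex (R : realType) (u : nat -> R) (l : R) :
  u @ \oo --> l ->
  (fun k => (u k)%:C%C : (R[i] : numClosedFieldType)) @ \oo -->
    (l%:C%C : (R[i] : numClosedFieldType)).
Proof.
move=> /cvgrPdist_lt ul; apply/cvgrPdist_lt => e e0.
(* In the partial order of the complex numbers, [0 < e] forces [e] to be real, which reduces the
   estimate to one over [R]. *)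
have e_re : e = (complex.Re e)%:C%C.
  by case: e e0 => a b; rewrite ltcE /= => /andP[/eqP -> _].
have re0 : 0 < complex.Re e by move: e0; rewrite {1}e_re ltcR.
near=> k; rewrite e_re -rmorphB /= normc_def /= expr0n /= addr0 sqrtr_sqr ltcR.
near: k; exact: ul.
Unshelve. all: by end_near. Qed.

Lemma cvg_series_expC (R : realType) (x : R) :
  series (fun k => k`!%:R^-1 * x%:C%C ^+ k : (R[i] : numClosedFieldType))
    @ \oo --> ((expR x)%:C%C : (R[i] : numClosedFieldType)).
Proof.
rewrite [X in X @ _](_ : _ =
    fun N => (series (exp_coeff x) N)%:C%C : (R[i] : numClosedFieldType)).
  by apply: cvg_real_complex; exact: is_cvg_series_exp_coeff.
apply/funext => N; rewrite /series /= rmorph_sum; apply: eq_bigr => k _.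
by rewrite /exp_coeff /= rmorphM rmorphXn fmorphV rmorph_nat mulrC.
Qed.

(** Meant for Gibbs states, with [c] equal to minus the inverse temperature. As [c] and [d] are
    real, the eigenvalues of [G] are real exponentials, hence positive; and [G] is diagonal in the
    same basis as the matrix it is built from. *)
Lemma mxexp_conj_diag_tr_comm (R : realType) n (V : 'M[R[i]]_n.+1)
    (V_unit : V \in unitmx) (d : 'rV[R[i]]_n.+1) (c : R) :
  d \is a realmx ->
  let G := mxexp (c%:C%C *: (invmx V *m diag_mx d *m V)) in
  \tr G != 0 /\ ad (invmx V *m diag_mx d *m V) G = 0.
Proof.
move=> d_real.
pose r i := c * complex.Re (d 0 i).
pose e : 'rV[R[i]]_n.+1 := \row_i (expR (r i))%:C%C.
have dE i : d 0 i = (complex.Re (d 0 i))%:C%C.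
  by rewrite RRe_real //; exact: mxOverP d_real 0 i.
rewrite scalemxAl scalemxAr -linearZ /=.
rewrite (@mxexp_conj_diag _ _ _ _ _ e) //; last first.
  move=> i; rewrite !mxE dE -rmorphM; exact: cvg_series_expC.
split.
  rewrite -mulmxA mxtrace_mulC -mulmxA mulmxV // mulmx1 mxtrace_diag gt_eqF //.
  (* The size [n.+1] provides a first summand, which is strictly positive; the others only have to
     be nonnegative. *)
  rewrite big_ord_recl ltr_pwDl ?sumr_ge0 // => [|i _]; rewrite mxE.
    by rewrite ltcR expR_gt0.
  by rewrite lecR expR_ge0.
exact: ad_conj_diag.
Qed.

(** * The adjoint action in an eigenbasis *)

Lemma ad_conj_coord (C : numClosedFieldType) n (V : 'M[C]_n)
    (V_unit : V \in unitmx) (d : 'rV[C]_n) (X : 'M[C]_n) i j :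
  (V *m ad (invmx V *m diag_mx d *m V) X *m invmx V) i j =
  (d 0 i - d 0 j) * (V *m X *m invmx V) i j.
Proof.
(* Conjugation by [V] is an algebra automorphism, so it carries commutators to commutators. *)
have -> : V *m ad (invmx V *m diag_mx d *m V) X *m invmx V =
    ad (diag_mx d) (V *m X *m invmx V).
  rewrite /ad mulmxBr mulmxBl !mulmxA mulmxV // mul1mx.
  by rewrite -[_ *m V *m invmx V]mulmxA mulmxV // mulmx1.
rewrite /ad mul_diag_mx mul_mx_diag; rewrite !mxE.
by rewrite mulrBl [X in _ - X]mulrC.
Qed.

Lemma ad_conj_delta (C : numClosedFieldType) n (V : 'M[C]_n)
    (V_unit : V \in unitmx) (d : 'rV[C]_n) i j :
  let F := invmx V *m delta_mx i j *m V in
  ad (invmx V *m diag_mx d *m V) F = (d 0 i - d 0 j) *: F.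
Proof.
set F := invmx V *m _ *m V => /=.
have Vi_unit : invmx V \in unitmx by rewrite unitmx_inv.
(* Multiplying by [V] on the left and by [invmx V] on the right is injective, so coordinates may be
   compared instead. *)
apply: (can_inj (mulKmx V_unit)); apply: (can_inj (mulmxK Vi_unit)).
apply/matrixP => k l; rewrite ad_conj_coord // -scalemxAr -scalemxAl [RHS]mxE.
have -> : V *m F *m invmx V = delta_mx i j.
  by rewrite !mulmxA mulmxV // mul1mx -mulmxA mulmxV // mulmx1.
by rewrite mxE; case: (k =P i) => [->|_]; case: (l =P j) => [->|_] //=;
  rewrite !mulr0.
Qed.

Lemma ord2_cases (i : 'I_2) : i = 0 \/ i = 1.
Proof. by case: i => -[|[|//]] ?; [left|right]; apply: val_inj. Qed.

Lemma off_diag_eigen (C : numClosedFieldType) (V : 'M[C]_2)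
    (V_unit : V \in unitmx) (d : 'rV[C]_2) (i j : 'I_2) (X : 'M[C]_2) :
  d 0 0 != d 0 1 -> i != j ->
  ad (invmx V *m diag_mx d *m V) X = (d 0 i - d 0 j) *: X ->
  exists c, X = c *: (invmx V *m delta_mx i j *m V).
Proof.
move=> d01 ij adX.
have dij : d 0 i != d 0 j.
  move: ij; case: (ord2_cases i) => ->; case: (ord2_cases j) => -> // _.
  by rewrite eq_sym.
have coord k l : (d 0 k - d 0 l - (d 0 i - d 0 j)) *
    (V *m X *m invmx V) k l = 0.
  have := ad_conj_coord V_unit d X k l.
  by rewrite adX -scalemxAr -scalemxAl mxE => E; rewrite mulrBl -E subrr.
have coord0 k l : (k, l) != (i, j) -> (V *m X *m invmx V) k l = 0.
  (* The gap at another position is 0 on the diagonal ([m = 0]) and the opposite gap at [(j, i)]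
     ([m = 1]). The factor in [coord] is then [d 0 i - d 0 j] times [-(m + 1)], nonzero in
     characteristic 0. *)
  move=> kl; have [m dkl] : exists m, d 0 k - d 0 l = - ((d 0 i - d 0 j) *+ m).
    move: ij kl; case: (ord2_cases i) => ->; case: (ord2_cases j) => -> // _;
    by case: (ord2_cases k) => ->; case: (ord2_cases l) => -> // _;
      do [by exists 0; rewrite subrr oppr0 | by exists 1; rewrite opprB].
  apply/eqP; have /eqP := coord k l.
  by rewrite dkl -opprD -mulrSr mulf_eq0 oppr_eq0 mulrn_eq0 /= subr_eq0
    (negPf dij).
exists ((V *m X *m invmx V) i j); rewrite [LHS](conjmx_delta_sum V_unit).
rewrite (bigD1 i) //= (bigD1 j) //= !big1 ?addr0 // => [k ki|l lj].
  by rewrite big1 // => l _; rewrite coord0 ?scale0r // xpair_eqE (negPf ki).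
by rewrite coord0 ?scale0r // xpair_eqE (negPf lj) andbF.
Qed.

Lemma conjmx_delta_sum2 (C : numClosedFieldType) (V : 'M[C]_2)
    (V_unit : V \in unitmx) (X : 'M[C]_2) :
  let x := V *m X *m invmx V in
  let F i j := invmx V *m delta_mx i j *m V in
  X = (x 0 1 *: F 0 1 + x 1 0 *: F 1 0) + (x 0 0 *: F 0 0 + x 1 1 *: F 1 1).
Proof.
move=> x F.
rewrite [LHS](conjmx_delta_sum V_unit) !big_ord_recl !big_ord0 !addr0.
have -> : lift ord0 ord0 = 1 :> 'I_2 by apply: val_inj.
by rewrite [X in X + _ = _]addrC addrACA.
Qed.

Lemma comm_diag_decomp (C : numClosedFieldType) (V : 'M[C]_2)
    (V_unit : V \in unitmx) (d : 'rV[C]_2) (X : 'M[C]_2) :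
  d 0 0 != d 0 1 -> ad (invmx V *m diag_mx d *m V) X = 0 ->
  X = (V *m X *m invmx V) 0 0 *: (invmx V *m delta_mx 0 0 *m V) +
      (V *m X *m invmx V) 1 1 *: (invmx V *m delta_mx 1 1 *m V).
Proof.
move=> d01 adX.
have coord k l : d 0 k != d 0 l -> (V *m X *m invmx V) k l = 0.
  move=> kl; apply/eqP; have := ad_conj_coord V_unit d X k l.
  rewrite adX mulmx0 mul0mx mxE => /esym/eqP.
  by rewrite mulf_eq0 subr_eq0 (negPf kl).
rewrite [LHS](conjmx_delta_sum2 V_unit) (coord 0 1) //.
by rewrite (coord 1 0) 1?eq_sym // !scale0r !add0r.
Qed.

Lemma mxtrace_conj_delta (C : numClosedFieldType) n (V : 'M[C]_n)
    (V_unit : V \in unitmx) i : \tr (invmx V *m delta_mx i i *m V) = 1.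
Proof.
rewrite -mulmxA mxtrace_mulC -mulmxA mulmxV // mulmx1 /mxtrace (bigD1 i) //=.
by rewrite big1 ?mxE ?eqxx ?addr0 // => j ji; rewrite mxE (negPf ji).
Qed.

(** The commutant of the diagonalized matrix is spanned by two diagonal units of trace 1, so a
    vanishing trace makes the two coefficients opposite. *)
Lemma traceless_comm_diag (C : numClosedFieldType) (V : 'M[C]_2)
    (V_unit : V \in unitmx) (d : 'rV[C]_2) (X : 'M[C]_2) :
  d 0 0 != d 0 1 -> ad (invmx V *m diag_mx d *m V) X = 0 -> \tr X = 0 ->
  exists c, X = c *: (invmx V *m delta_mx 0 0 *m V -
                      invmx V *m delta_mx 1 1 *m V).
Proof.
move=> d01 /(comm_diag_decomp V_unit d01) ->.
move: (_ 0 0) (_ 1 1) => a b.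
rewrite linearD !linearZ /= !mxtrace_conj_delta // !mulr1 => /eqP.
by rewrite addr_eq0 => /eqP ->; exists (- b); rewrite scalerBr !scaleNr opprK.
Qed.

(** * Covariant maps and their common eigenbasis *)

Section CovariantMaps.
Variables (C : numClosedFieldType) (V : 'M[C]_2) (d : 'rV[C]_2) (G : 'M[C]_2).
Hypotheses (V_unit : V \in unitmx) (d01 : d 0 0 != d 0 1).
Let H := invmx V *m diag_mx d *m V.
Let F i j := invmx V *m delta_mx i j *m V.
Hypotheses (adG : ad H G = 0) (trG : \tr G != 0).

(** [G] stands for the Gibbs state, entering through [adG] and [trG]; finite and infinite
    temperatures are thus treated alike. *)
Definition covariant (S : {linear 'M[C]_2 -> 'M[C]_2}) :=
  [/\ trace_preserving S, S G = G & forall X, S (ad H X) = ad H (S X)].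

Let adD X Y : ad H (X + Y) = ad H X + ad H Y.
Proof. by rewrite /ad mulmxDr mulmxDl opprD addrACA. Qed.

Let adZ a X : ad H (a *: X) = a *: ad H X.
Proof. by rewrite /ad -scalemxAr -scalemxAl scalerBr. Qed.

Let adF i : ad H (F i i) = 0.
Proof. by rewrite ad_conj_delta // subrr scale0r. Qed.

Let Z := F 0 0 - F 1 1.

Let adZ0 : ad H Z = 0.
Proof. by rewrite /Z -scaleN1r adD adZ !adF scaler0 addr0. Qed.

Let trZ : \tr Z = 0.
Proof. by rewrite linearB /= !mxtrace_conj_delta // subrr. Qed.

(** [S] preserves each eigenspace of [ad H], and the one containing [F i j] is a line. *)
Lemma covariant_off_diag S i j : covariant S -> i != j ->
  exists c, S (F i j) = c *: F i j.
Proof.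
move=> [_ _ Sad] ij; apply: (off_diag_eigen V_unit d01 ij).
by rewrite -Sad ad_conj_delta // linearZ.
Qed.

Lemma covariant_traceless S : covariant S -> exists c, S Z = c *: Z.
Proof.
move=> [Str _ Sad]; apply: (traceless_comm_diag V_unit d01).
  by rewrite -Sad adZ0 linear0.
by rewrite Str.
Qed.

Lemma eigen_basis X : exists a b c e,
  X = a *: F 0 1 + b *: F 1 0 + (c *: Z + e *: G).
Proof.
pose x := V *m X *m invmx V.
pose D := x 0 0 *: F 0 0 + x 1 1 *: F 1 1.
(* This coefficient makes [D - e *: G] traceless; being still in the kernel of [ad H], the
   difference is a multiple of [Z]. *)
pose e := \tr D / \tr G.
have [c DE] : exists c, D - e *: G = c *: Z.
  apply: (traceless_comm_diag V_unit d01).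
    by rewrite -scaleNr !adD !adZ !adF adG !scaler0 !addr0.
  by rewrite linearB linearZ /= divfK // subrr.
exists (x 0 1), (x 1 0), c, e; rewrite -DE subrK.
exact: conjmx_delta_sum2.
Qed.

Lemma covariant_comm S1 S2 : covariant S1 -> covariant S2 ->
  S1 \o S2 =1 S2 \o S1.
Proof.
move=> S1c S2c X /=; have [a [b [c [e ->]]]] := eigen_basis X.
(* On a common eigenvector the two maps act by scalars, which commute. *)
have swap B : (exists k, S1 B = k *: B) -> (exists k, S2 B = k *: B) ->
    S1 (S2 B) = S2 (S1 B).
  by move=> [k Ek] [l El]; rewrite El Ek !linearZ /= Ek El !scalerA mulrC.
have [_ S1G _] := S1c; have [_ S2G _] := S2c.
have := swap Z (covariant_traceless S1c) (covariant_traceless S2c).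
(* Generalizing [Z] hides its body, so that the linearity rewrites treat it as an atom and do not
   split it. *)
move: (Z) => B SB; rewrite !(linearD, linearZ) /= !(S1G, S2G) SB.
by rewrite !swap //; exact: covariant_off_diag.
Qed.

End CovariantMaps.

(** * Hermitian Hamiltonians and their Gibbs states *)

Lemma gibbs_comm_tr (R : realType) (T : \bar R) n (H : 'M[R[i]]_n.+1) :
  H \is hermsymmx -> \tr (gibbs H T) != 0 /\ ad H (gibbs H T) = 0.
Proof.
(* This settles the infinite values of [T], where [gibbs] is the identity. *)
have id_case : \tr (1%:M : 'M[R[i]]_n.+1) != 0 /\ ad H 1%:M = 0.
  by rewrite mxtrace1 pnatr_eq0 /ad mulmx1 mul1mx subrr.
case: T => [t| |] //= H_herm.
have /hermitian_normalmx/orthomx_spectralP H_spec := H_herm.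
have := mxexp_conj_diag_tr_comm (spectral_unit H) (- t^-1)
  (hermitian_spectral_diag_real H_herm).
by rewrite -H_spec rmorphN.
Qed.

(** If the two diagonal entries agreed, [H] would be a scalar matrix and have a single
    eigenvalue. *)
Lemma spectral_diag_neq (C : numClosedFieldType) (H : 'M[C]_2) (a b : C) :
  H \is hermsymmx -> a != b -> eigenvalue H a -> eigenvalue H b ->
  spectral_diag H 0 0 != spectral_diag H 0 1.
Proof.
move=> /hermitian_normalmx/orthomx_spectralP H_spec ab Ha Hb.
apply/eqP => d01; set c := spectral_diag H 0 1 in d01.
have Hc : H = c%:M.
  rewrite H_spec (_ : diag_mx _ = c%:M) ?mul_mx_scalar -?scalemxAl ?mulVmx.
  - by rewrite scalemx1.
  - exact: spectral_unit.
  - rewrite -diag_const_mx; congr diag_mx; apply/rowP => i; rewrite mxE.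
    by case: (ord2_cases i) => ->.
have uniq_eig e : eigenvalue H e -> e = c.
  case/eigenvalueP => v; rewrite Hc mul_mx_scalar => /eqP.
  rewrite -subr_eq0 -scalerBl scaler_eq0 subr_eq0.
  by case/orP => [/eqP-> //|/eqP->]; rewrite eqxx.
by rewrite (uniq_eig _ Ha) (uniq_eig _ Hb) eqxx in ab.
Qed.

Theorem corollary9 (R : realType) (T : \bar R) (T_gt0 : (0 < T)%E)
    (H : 'M[R[i]]_2) (H_herm : H \is hermsymmx)
    (H_nondeg : exists a b : R[i],
        [/\ a != b, eigenvalue H a & eigenvalue H b]) :
  (forall S1 S2 : {linear 'M[R[i]]_2 -> 'M[R[i]]_2},
     EnTO H T S1 -> EnTO H T S2 -> S1 \o S2 =1 S2 \o S1) /\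
  (forall A : set {linear 'M[R[i]]_2 -> 'M[R[i]]_2}, A `<=` EnTO H T ->
     forall S1 S2, A S1 -> A S2 -> S1 \o S2 =1 S2 \o S1).
Proof.
(* The clause on subsets follows by inclusion. *)
suff comm S1 S2 : EnTO H T S1 -> EnTO H T S2 -> S1 \o S2 =1 S2 \o S1.
  by split=> // A AE S1 S2 /AE + /AE; exact: comm.
have [a [b [ab Ha Hb]]] := H_nondeg.
have d01 := spectral_diag_neq H_herm ab Ha Hb.
have [trG adG] := gibbs_comm_tr T H_herm.
have H_spec := orthomx_spectralP (hermitian_normalmx H_herm).
have cov S : EnTO H T S ->
    covariant (spectralmx H) (spectral_diag H) (gibbs H T) S.
  move=> [_ Str SG Sad]; split=> // X.
  by rewrite -H_spec; apply/eqP; rewrite -subr_eq0 Sad.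
move=> /cov S1c /cov S2c.
by apply: covariant_comm S1c S2c; rewrite -?H_spec //; exact: spectral_unit.
Qed.
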